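(* Let $A,B,C$ be real matrices of sizes $n\times n$, $n\times r$, $r\times n$ with $\operatorname{rank}B=r$, $(A,B)$ controllable with controllability index $\nu\ge2$, and $P(s)=\begin{bmatrix} sI_n-A & -B \\ C & O \end{bmatrix}$ of normal rank $n+r$. Then the system zeros of $\dot x=Ax+Bu$, $y=Cx$ coincide with the generalized eigenvalues of the $(n-l_{\nu-1})\times(n-l_{\nu-1})$ regular matrix pencil $$Z(s)=s\begin{bmatrix} I_\beta & O \\ O & C_\nu \end{bmatrix}+\begin{bmatrix} -\bar E \\ C_1,\;C_2,\;\dots,\;C_{\nu-2},\;[O,C_{\nu-1}] \end{bmatrix}$$ (i.e. the zeros of $\det Z(s)$, with multiplicity) with $r-l_{\nu-1}$ generalized eigenvalues at the origin removed. Here $\beta=l_1+\cdots+l_{\nu-2}$, $[O,C_{\nu-1}]$ is $r\times r$, and $\bar E$ is the $\beta\times(n-l_{\nu-1})$ matrix $$\bar E=\begin{bmatrix} O & E_{1,2} & O & \cdots & O \\ O & O & E_{2,3} & \cdots & O \\ \vdots & & & \ddots & \vdots \\ O & O & O & \cdots & E^o_{\nu-2,\nu-1} \end{bmatrix}$$ with row blocks of sizes $l_1,\dots,l_{\nu-2}$, column blocks of sizes $l_1,\dots,l_{\nu-2},r$, $E_{i,i+1}=[O,I_{l_i}]$ of size $l_i\times l_{i+1}$, and $E^o_{\nu-2,\nu-1}=[O,I_{l_{\nu-2}}]$ of size $l_{\nu-2}\times r$. The integers $l_i$ and matrices $C_i$ come from the Yokoyama canonical form as in the context.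
   Context: Controllability index: the smallest $\nu$ with $\operatorname{rank}[B,AB,\dots,A^{\nu-1}B]=\operatorname{rank}[B,\dots,A^{n-1}B]$. Integers $l_1\le\cdots\le l_\nu=r$ are defined by $l_\nu=\operatorname{rank}B$ and $l_{\nu-k}=\operatorname{rank}[B,\dots,A^{k}B]-\operatorname{rank}[B,\dots,A^{k-1}B]$, $k=1,\dots,\nu-1$; then $l_1+\cdots+l_\nu=n$. Yokoyama canonical form: there are a nonsingular $n\times n$ matrix $N$ and an $r\times r$ permutation matrix $M$ such that $$NAN^{-1}=\begin{bmatrix} O & E_{1,2} & O & \cdots & O \\ O & O & E_{2,3} & \cdots & O \\ \vdots & & & \ddots & \vdots \\ O & O & O & \cdots & E_{\nu-1,\nu} \\ F_{\nu 1} & F_{\nu 2} & F_{\nu 3} & \cdots & F_{\nu\nu} \end{bmatrix},\qquad NBM=\begin{bmatrix} O \\ G_\nu \end{bmatrix},$$ with block sizes $l_1,\dots,l_\nu$, $E_{i,i+1}=[O,I_{l_i}]$ of size $l_i\times l_{i+1}$, and $G_\nu$ an $r\times r$ lower triangular matrix with unit diagonal. Fix such $N,M$ and partition $CN^{-1}=[C_1,\dots,C_\nu]$ with $C_i$ of size $r\times l_i$. For $\nu=2$ one has $\beta=0$, $\bar E$ is empty and $Z(s)=sC_2+[O,C_1]$. In this square case the system zeros are the zeros of the polynomial $\det P(s)$, which is not identically zero by the normal rank assumption. A matrix pencil $sX+Y$ is regular if it is square with $\det(sX+Y)\not\equiv0$. *)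

(* Defs.v *)
From mathcomp Require Import all_boot all_order all_algebra.
From mathcomp Require Import complex reals.

Set Implicit Arguments.
Unset Strict Implicit.
Unset Printing Implicit Defensive.

Import GRing.Theory.
Local Open Scope ring_scope.

Definition ctrb (F : fieldType) n r (A : 'M[F]_n) (B : 'M[F]_(n, r)) (k : nat) :
    'M[F]_(n, \sum_(j < k) r) :=
  \mxrow_(j < k) (A ^+ j *m B).

Definition controllable (F : fieldType) n r (A : 'M[F]_n) (B : 'M[F]_(n, r)) : Prop :=
  \rank (ctrb A B n) = n.

Lemma ctrb_index_exists (F : fieldType) n r (A : 'M[F]_n) (B : 'M[F]_(n, r)) :
  exists k, \rank (ctrb A B k) == \rank (ctrb A B n).
Proof. by exists n. Qed.

Definition ctrb_index (F : fieldType) n r (A : 'M[F]_n) (B : 'M[F]_(n, r)) : nat :=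
  ex_minn (ctrb_index_exists A B).

(* The integers l_1 <= ... <= l_nu (the argument i is 1-based, i = nu - k).
   For i = nu the subtracted rank is that of the empty matrix [ctrb A B 0],
   so l_nu = rank B. *)
Definition ctrb_size (F : fieldType) n r (A : 'M[F]_n) (B : 'M[F]_(n, r)) (i : nat) : nat :=
  let k := (ctrb_index A B - i)%N in
  (\rank (ctrb A B k.+1) - \rank (ctrb A B k))%N.

Lemma rank_ctrb (F : fieldType) n r (A : 'M[F]_n) (B : 'M[F]_(n, r)) k :
  \rank (ctrb A B k) = \rank (\sum_(j < k) <<(A ^+ j *m B)^T>>)%MS.
Proof. by rewrite -mxrank_tr /ctrb tr_mxrow eqmx_col. Qed.

Lemma rank_ctrb0 (F : fieldType) n r (A : 'M[F]_n) (B : 'M[F]_(n, r)) :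
  \rank (ctrb A B 0) = 0%N.
Proof. by rewrite rank_ctrb big_ord0 mxrank0. Qed.

Lemma rank_ctrb1 (F : fieldType) n r (A : 'M[F]_n) (B : 'M[F]_(n, r)) :
  \rank (ctrb A B 1) = \rank B.
Proof. by rewrite rank_ctrb big_ord1 genmxE mxrank_tr expr0 mul1mx. Qed.

Lemma rank_ctrbS (F : fieldType) n r (A : 'M[F]_n) (B : 'M[F]_(n, r)) k :
  (\rank (ctrb A B k) <= \rank (ctrb A B k.+1))%N.
Proof. by rewrite !rank_ctrb big_ord_recr /= mxrankS // addsmxSl. Qed.

Lemma ctrb_size_sum (F : fieldType) n r m (A : 'M[F]_n) (B : 'M[F]_(n, r)) :
  controllable A B -> ctrb_index A B = m.+2 ->
  (\sum_(i < m.+2) ctrb_size A B i.+1 = n)%N.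
Proof.
move=> cAB nuE; rewrite (reindex_inj rev_ord_inj) /=.
have -> : (\sum_(j < m.+2) ctrb_size A B (m.+2 - j.+1).+1 =
  \sum_(0 <= j < m.+2) (\rank (ctrb A B j.+1) - \rank (ctrb A B j)))%N.
  rewrite big_mkord; apply: eq_bigr => j _.
  suff E : (m.+2 - (m.+2 - j.+1).+1 = j)%N by rewrite /ctrb_size nuE E.
  by rewrite subnSK // subKn // ltnW.
rewrite telescope_sumn; last first.
  by apply: homo_leq => //; [exact: leq_trans | exact: rank_ctrbS].
rewrite rank_ctrb0 subn0 -nuE /ctrb_index.
by case: ex_minnP => k /eqP ->.
Qed.

Lemma ctrb_size_last (F : fieldType) n r m (A : 'M[F]_n) (B : 'M[F]_(n, r)) :
  \rank B = r -> ctrb_index A B = m.+2 -> ctrb_size A B m.+2 = r.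
Proof.
by move=> rB nuE; rewrite /ctrb_size nuE subnn rank_ctrb0 rank_ctrb1 subn0.
Qed.

(* [O, I_p] of size p x q, for p <= q.  Consequently X *m pad_id p q = [O, X]. *)
Definition pad_id (F : fieldType) (p q : nat) : 'M[F]_(p, q) :=
  \matrix_(i, j) (i + q == j + p)%N%:R.

(* X is N A N^-1 and Y is N B M, cut along blocks of sizes l 1, ..., l nu
   (block i : 'I_nu, counted from 0, has size l i.+1), with nu = m.+2.
   The last block row of X, made of the F_(nu, j), is arbitrary, and the last
   block of Y is G_nu. *)
Definition yokoyama_shape (F : fieldType) (r m : nat) (l : nat -> nat)
    (lr : l m.+2 = r)
    (X : 'M[F]_(\sum_(i < m.+2) l i.+1)) (Y : 'M[F]_(\sum_(i < m.+2) l i.+1, r)) : Prop :=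
  let G := castmx (lr, erefl r) (submxcol (p_ := fun i : 'I_m.+2 => l i.+1) Y ord_max) in
  [/\ forall i j : 'I_m.+2, (i < m.+1)%N ->
        submxblock (p_ := fun i : 'I_m.+2 => l i.+1) (q_ := fun j : 'I_m.+2 => l j.+1) X i j
          = if j == i.+1 :> nat then pad_id F (l i.+1) (l j.+1) else 0,
      forall i : 'I_m.+2, (i < m.+1)%N ->
        submxcol (p_ := fun i : 'I_m.+2 => l i.+1) Y i = 0,
      is_trig_mx G
    & forall i, G i i = 1].

Definition yokoyama_form (F : fieldType) n r m (A : 'M[F]_n) (B : 'M[F]_(n, r))
    (rB : \rank B = r) (cAB : controllable A B) (nuE : ctrb_index A B = m.+2)
    (N : 'M[F]_n) (M : 'M[F]_r) : Prop :=
  let e := esym (ctrb_size_sum cAB nuE) in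
  [/\ N \in unitmx, is_perm_mx M
    & yokoyama_shape (ctrb_size_last rB nuE)
        (castmx (e, e) (N *m A *m invmx N)) (castmx (e, erefl r) (N *m B *m M))].

Definition pencil (F : fieldType) p q (X Y : 'M[F]_(p, q)) : 'M[{poly F}]_(p, q) :=
  'X *: map_mx polyC X + map_mx polyC Y.

Definition regular_pencil (F : fieldType) p (X Y : 'M[F]_p) : Prop :=
  \det (pencil X Y) != 0.

Definition system_mx (F : fieldType) n r (A : 'M[F]_n) (B : 'M[F]_(n, r))
    (C : 'M[F]_(r, n)) : 'M[{poly F}]_(n + r) :=
  block_mx ('X%:M - map_mx polyC A) (- map_mx polyC B) (map_mx polyC C) 0.

Definition normal_rank (F : fieldType) p q (P : 'M[{poly F}]_(p, q)) : nat :=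
  \rank (map_mx (@FracField.tofrac {poly F}) P).

(* Multiplicity of the complex number z as a zero of the real polynomial p. *)
Definition zero_mult (R : rcfType) (p : {poly R}) (z : R[i]) : nat :=
  mup z (map_poly (real_complex R) p).

(* With nu = m.+2: the block column sizes of Ebar are l 1, ..., l m, then r;
   the block I_(l i) sits in block column i + 1, the last one being E^o. *)
Definition Ebar (F : fieldType) (r m : nat) (l : nat -> nat) :
    'M[F]_(\sum_(i < m) l i.+1, \sum_(i < m) l i.+1 + r) :=
  row_mx
    (\mxblock_(i < m, j < m)
       (if j == i.+1 :> nat then pad_id F (l i.+1) (l j.+1) else 0))
    (\mxcol_(i < m) (if i.+1 == m then pad_id F (l i.+1) r else 0)).

(* The block C_(i+1) of C N^-1 = [C_1, ..., C_nu], i counted from 0. *)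
Definition col_block (F : fieldType) (r nu : nat) (l : nat -> nat)
    (X : 'M[F]_(r, \sum_(i < nu) l i.+1)) (i : 'I_nu) : 'M[F]_(r, l i.+1) :=
  submxrow (q_ := fun i : 'I_nu => l i.+1) X i.

Definition Zlead (F : fieldType) (r m : nat) (l : nat -> nat) (lr : l m.+2 = r)
    (CN : 'M[F]_(r, \sum_(i < m.+2) l i.+1)) : 'M[F]_(\sum_(i < m) l i.+1 + r) :=
  block_mx 1%:M 0 0 (castmx (erefl r, lr) (col_block CN ord_max)).

Definition Zconst (F : fieldType) (r m : nat) (l : nat -> nat)
    (CN : 'M[F]_(r, \sum_(i < m.+2) l i.+1)) : 'M[F]_(\sum_(i < m) l i.+1 + r) :=
  col_mx
    (- Ebar F r m l)
    (row_mx
       (\mxrow_(i < m) col_block CN (widen_ord (leqW (leqnSn m)) i))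
       (col_block CN (Ordinal (leqnSn m.+1)) *m pad_id F (l m.+1) r)).

(* Main.v *)
Require Import Defs.
From mathcomp Require Import all_boot all_order all_algebra.
From mathcomp Require Import complex reals zify.
Set Implicit Arguments.
Unset Strict Implicit.
Unset Printing Implicit Defensive.
Local Open Scope ring_scope.
Import GRing.Theory.

(**
By the Yokoyama form, [det P(s)] equals, up to a nonzero constant, [det Q(s)] with

  [Q(s) = [[s I - E_11, -V, 0], [0, s I_p, -E], [D_1, D_2, D_3]]],  [p = l_(nu-1)],

where [E_11] and [V] are the first [nu-2] block rows of [N A N^-1], [E = [O, I_p]]
and [[D_1, D_2, D_3] = C N^-1]: the unit triangular block [G_nu] eliminates the
last block row of the state equation.  Right multiplication of [Q(s)] by
[T(s) = [[I, 0, 0], [0, I_p, E], [0, 0, s I_r]]] kills the entry [-E], and leaves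
[V E] and [D_2 E + s D_3] in the last block column.  Since [V E] is the last block
column of [Ebar], the rows and columns other than the middle ones form [Z(s)],
whence [s^r det Q(s) = s^p det Z(s)].  The identity for [V E] and the inequality
[p <= r] both come from the monotonicity of the [l_i].
*)

(** * Monotonicity of the block sizes *)

(* If [V_k] is the column space of [B, ..., A^(k-1) B] and [U] a complement of
   [V_k] in [V_(k+1)], then [V_(k+2) = V_(k+1) + A U]. *)
Lemma ctrb_rank_concave (F : fieldType) n r (A : 'M[F]_n) (B : 'M[F]_(n, r)) k :
  (\rank (ctrb A B k.+2) - \rank (ctrb A B k.+1) <=
   \rank (ctrb A B k.+1) - \rank (ctrb A B k))%N.
Proof.
(* Subspaces are encoded by rows, hence the transposes. *)
pose V k := (\sum_(j < k) <<(A ^+ j *m B)^T>>)%MS.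
have VS j : (V j.+1 :=: V j + (A ^+ j *m B)^T)%MS.
  by rewrite /V big_ord_recr /=; apply: adds_eqmx => //; exact: genmxE.
have VA j : (V j *m A^T <= V j.+1)%MS.
  rewrite /V sumsmxMr; apply/sumsmx_subP => i _.
  apply: submx_trans (_ : _ <= <<(A ^+ i.+1 *m B)^T>>)%MS _; last first.
    by apply: (sumsmx_sup (lift ord0 i)).
  by rewrite !genmxE (eqmxMr _ (genmxE _)) -trmx_mul exprS mulmxA.
rewrite !rank_ctrb -/(V _) -/(V k.+1) -/(V k).
set U := (V k.+1 :\: V k)%MS.
have VkS : (V k <= V k.+1)%MS by rewrite VS addsmxSl.
have rU : (\rank U + \rank (V k) = \rank (V k.+1))%N.
  by rewrite -(mxrank_cap_compl (V k.+1) (V k)) addnC (capmx_idPr VkS).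
(* A^k B lies in V_k + U, and A V_k is contained in V_(k+1). *)
have V2 : (V k.+2 <= V k.+1 + U *m A^T)%MS.
  rewrite (VS k.+1) addsmx_sub addsmxSl /=.
  rewrite exprS -mulmxA -[(A *m _)]/(A *m (A ^+ k *m B)) trmx_mul.
  have sub : ((A ^+ k *m B)^T <= V k + U)%MS.
    apply: (@submx_trans _ _ _ _ _ _ (V k.+1)); first by rewrite VS addsmxSr.
    apply: (@submx_trans _ _ _ _ _ _ (U + V k.+1 :&: V k)%MS).
      by rewrite addsmx_diff_cap_eq.
    by rewrite addsmxC addsmxS ?capmxSr.
  by rewrite (submx_trans (submxMr _ sub)) // addsmxMr addsmxS.
have := leq_trans (mxrankS V2) (mxrank_adds_leqif _ _).
have := mxrankM_maxl U A^T.
by move: rU => /=; lia.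
Qed.

(** * Determinants of block matrices *)

(** [m] and [n] are kept apart because sizes such as b + p + r and b + r + p are equal but not
    convertible. *)
Lemma det_mxconj (R : comPzRingType) m n (P : 'M[R]_(m, n)) (Q : 'M[R]_(n, m)) (A : 'M[R]_n) :
  m = n -> P *m Q = 1%:M -> \det (P *m A *m Q) = \det A.
Proof.
move=> e; case: _ / e P Q A => P Q A PQ.
by rewrite !det_mulmx mulrAC -det_mulmx PQ det1 mul1r.
Qed.

Definition swap_mx (R : pzRingType) b p r : 'M[R]_(b + r + p, b + p + r) :=
  block_mx (block_mx 1%:M 0 0 0) (col_mx 0 1%:M) (row_mx 0 1%:M) 0.

Lemma swap_mxK (R : pzRingType) b p r : swap_mx R b p r *m swap_mx R b r p = 1%:M.
Proof.
rewrite mulmx_block mul_row_block mulmx_block mul_block_col mul_row_col mul_col_row.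
rewrite add_block_mx !(mulmx0, mul0mx, mulmx1, addr0, add0r, col_mx0, row_mx0).
by rewrite -!scalar_mx_block.
Qed.

Lemma swap_mx_conj (R : pzRingType) b p r (A11 : 'M[R]_b) A12 A21 (A22 : 'M[R]_p)
    A13 A23 A31 A32 (A33 : 'M[R]_r) :
  swap_mx R b p r *m
    block_mx (block_mx A11 A12 A21 A22) (col_mx A13 A23) (row_mx A31 A32) A33 *m
    swap_mx R b r p =
  block_mx (block_mx A11 A13 A31 A33) (col_mx A12 A32) (row_mx A21 A23) A22.
Proof.
pose simp := (mulmx0, mul0mx, mulmx1, mul1mx, addr0, add0r, col_mx0, row_mx0).
set A := block_mx (block_mx A11 _ _ _) _ _ _.
have -> : swap_mx R b p r *m A =
    block_mx (block_mx A11 A12 A31 A32) (col_mx A13 A33) (row_mx A21 A22) A23.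
  rewrite mulmx_block mul_row_block mulmx_block !mul_block_col !mul_row_col mul_col_row.
  by rewrite !mul_col_mx !(add_block_mx, add_col_mx, simp).
rewrite /swap_mx mulmx_block mul_row_block mulmx_block !mul_block_col !mul_row_col mul_col_row.
by rewrite !mul_mx_row !(add_row_mx, add_block_mx, add_col_mx, simp).
Qed.

(** Swapping the last two block rows gives a block lower triangular matrix with diagonal blocks
    [W; D] and G. *)
Lemma det_bordered (R : comPzRingType) n r (W : 'M[R]_(n, n + r))
    (V D : 'M[R]_(r, n + r)) (G : 'M[R]_r) :
  \det (swap_mx R n r r) * \det (block_mx (col_mx W V) (col_mx 0 G) D 0) =
  \det (col_mx W D) * \det G.
Proof.
rewrite -det_mulmx mulmx_block !mul_block_col !mul_row_col.
rewrite !(mulmx0, mul0mx, mul1mx, addr0, add0r) mul_col_mx !(mul0mx, mul1mx).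
by rewrite add_col_mx !(addr0, add0r, col_mx0) det_lblock.
Qed.

(** Both powers of [s] are kept, so that [s] can be the indeterminate, which has no inverse. *)
Lemma det_chain_elim (R : comPzRingType) b p r (s : R) (U : 'M[R]_b)
    (V : 'M[R]_(b, p)) (E : 'M[R]_(p, r)) (D1 : 'M[R]_(r, b)) (D2 : 'M[R]_(r, p))
    (D3 : 'M[R]_r) :
  s ^+ p * \det (block_mx U (V *m E) D1 (D2 *m E + s *: D3)) =
  s ^+ r *
  \det (block_mx (block_mx U V 0 s%:M) (col_mx 0 (- E)) (row_mx D1 D2) D3).
Proof.
pose T : 'M[R]_(b + p + r) := block_mx 1%:M (col_mx 0 E) 0 s%:M.
have QT : block_mx (block_mx U V 0 s%:M) (col_mx 0 (- E)) (row_mx D1 D2) D3 *m T =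
    block_mx (block_mx U V 0 s%:M) (col_mx (V *m E) 0) (row_mx D1 D2)
      (D2 *m E + s *: D3).
  rewrite mulmx_block !(mulmx0, mulmx1, addr0) mul_block_col !mul_mx_scalar.
  rewrite mul_row_col !(mulmx0, add0r, scale_col_mx, add_col_mx, scaler0, addr0).
  by rewrite mul_scalar_mx scalerN subrr.
have <- : \det T = s ^+ r by rewrite det_ublock det1 mul1r det_scalar.
rewrite mulrC [RHS]mulrC -det_mulmx QT.
(* Moving the middle block to the end makes the product block upper triangular, with last diagonal
   block s I_p. *)
rewrite -(det_mxconj _ (addnAC b r p) (swap_mxK _ b p r)).
by rewrite swap_mx_conj row_mx0 det_ublock det_scalar.
Qed.

(** * Change of coordinates in the system matrix *)

Lemma system_mx_cast (F : fieldType) n n' r (e : n = n') (A : 'M[F]_n)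
    (B : 'M[F]_(n, r)) (C : 'M[F]_(r, n)) :
  \det (system_mx (castmx (e, e) A) (castmx (e, erefl r) B) (castmx (erefl r, e) C)) =
  \det (system_mx A B C).
Proof. by case: _ / e; rewrite !castmx_id. Qed.

(** The new system matrix is diag(N, I) P(s) diag(N^-1, M), and det N cancels. *)
Lemma det_system_mx_equiv (F : fieldType) n r (A : 'M[F]_n) (B : 'M[F]_(n, r))
    (C : 'M[F]_(r, n)) (N : 'M[F]_n) (M : 'M[F]_r) :
  N \in unitmx ->
  \det (system_mx (N *m A *m invmx N) (N *m B *m M) (C *m invmx N)) =
  \det (system_mx A B C) * (\det M)%:P.
Proof.
move=> uN; pose L : 'M_(n + r) := block_mx (map_mx polyC N) 0 0 1%:M.
pose K : 'M_(n + r) := block_mx (map_mx polyC (invmx N)) 0 0 (map_mx polyC M).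
have -> : system_mx (N *m A *m invmx N) (N *m B *m M) (C *m invmx N) =
    L *m system_mx A B C *m K.
  rewrite !mulmx_block !(mulmx0, mul0mx, addr0, add0r, mul1mx) -!map_mxM.
  rewrite mulmxBr mulmxBl mul_mx_scalar -scalemxAl -!map_mxM mulmxV // map_mx1.
  by rewrite scalemx1 mulmxN mulNmx -!map_mxM.
rewrite !det_mulmx !det_ublock !det_map_mx det1 mulr1.
rewrite mulrAC mulrA -!rmorphM /= -det_mulmx mulmxV // det1 mul1r.
exact: mulrC.
Qed.

(** * Regrouping the Yokoyama form into three blocks *)

Lemma pad_id_mul (F : fieldType) p q t :
  (p <= q)%N -> pad_id F p q *m pad_id F q t = pad_id F p t.
Proof.
move=> pq; apply/matrixP => i k; rewrite !mxE.
(* The only 1 in row i of [pad_id F p q] is in column i + q - p, which exists as p <= q. *)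
have lt_j : (i + q - p < q)%N by have := ltn_ord i; lia.
rewrite (bigD1 (Ordinal lt_j)) //= big1 ?addr0 => [|j /eqP neq_j].
  by rewrite !mxE /= -natrM mulnb; congr (_%:R); lia.
rewrite !mxE; case: eqP => [e|]; last by rewrite mul0r.
by case: neq_j; apply: val_inj => /=; lia.
Qed.

Section BlockShape.

Variables (m : nat) (l : nat -> nat).
Local Notation b := (\sum_(i < m) l i.+1)%N.
Local Notation p := (fun i : 'I_m.+2 => l i.+1).

(** These are the ordinals of [Zconst], so that both forms agree by conversion. *)
Definition first_block (i : 'I_m) : 'I_m.+2 := widen_ord (leqW (leqnSn m)) i.
Definition penult_block : 'I_m.+2 := Ordinal (leqnSn m.+1).

Lemma sum_split_last2 : (\sum_(i < m.+2) l i.+1 = b + l m.+1 + l m.+2)%N.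
Proof. by rewrite !big_ord_recr. Qed.

(** A block starts at the total size of the blocks before it; the last two blocks contribute nothing
    here. *)
Lemma cast_ord_first (i : 'I_b) :
  cast_ord (esym sum_split_last2) (lshift _ (lshift _ i)) =
  tagnat.Rank (p_ := p) (first_block (tagnat.sig1 i)) (tagnat.sig2 i).
Proof.
apply: ord_inj; apply: etrans _ (esym (tagnat.RankEsum (p_ := p) _)).
rewrite /= [LHS]tagnat.rect; congr addn.
rewrite [RHS]big_mkcond /= !big_ord_recr /=.
rewrite !ltnNge (ltnW (ltn_ord _)) ltnW ?ltnS 1?ltnW //= !addn0.
by rewrite big_mkcond; apply: eq_bigr => j _; rewrite ltnNge.
Qed.

Lemma cast_ord_penult (i : 'I_(l m.+1)) :
  cast_ord (esym sum_split_last2) (lshift _ (rshift _ i)) =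
  tagnat.Rank (p_ := p) penult_block i.
Proof.
apply: ord_inj; apply: etrans _ (esym (tagnat.RankEsum (p_ := p) _)); congr addn.
rewrite [RHS]big_mkcond /= !big_ord_recr /= !ltnn /= ltnNge leqnSn !addn0.
by apply: eq_bigr => j _; rewrite ltn_ord.
Qed.

Lemma cast_ord_last (i : 'I_(l m.+2)) :
  cast_ord (esym sum_split_last2) (rshift _ i) = tagnat.Rank (p_ := p) ord_max i.
Proof.
apply: ord_inj; apply: etrans _ (esym (tagnat.RankEsum (p_ := p) _)); congr addn.
rewrite [RHS]big_mkcond /= !big_ord_recr /= !ltnn /= ltnSn !addn0; congr addn.
by apply: eq_bigr => j _; rewrite ltnS ltnW.
Qed.

End BlockShape.

Definition chain_mx (F : fieldType) m (l : nat -> nat) : 'M[F]_(\sum_(i < m) l i.+1) :=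
  \mxblock_(i < m, j < m) (if j == i.+1 :> nat then pad_id F (l i.+1) (l j.+1) else 0).

(** For q = l_(nu-1) this is V; for q = r it is the last block column of [Ebar]. *)
Definition chain_link (F : fieldType) m (l : nat -> nat) q :
    'M[F]_(\sum_(i < m) l i.+1, q) :=
  \mxcol_(i < m) (if i.+1 == m then pad_id F (l i.+1) q else 0).

(** [XL] and [XR] stay arbitrary: the elimination through [G] discards them. *)
Lemma yokoyama_blocks (F : fieldType) m (l : nat -> nat)
    (X : 'M[F]_(\sum_(i < m.+2) l i.+1)) (Y : 'M[F]_(_, l m.+2)) :
  let e := sum_split_last2 m l in
  yokoyama_shape (erefl (l m.+2)) X Y ->
  exists XL XR, exists2 G,
    castmx (e, e) X =
      block_mx (block_mx (chain_mx F m l) (chain_link F m l (l m.+1)) 0 0)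
        (col_mx 0 (pad_id F (l m.+1) (l m.+2))) XL XR &
    castmx (e, erefl _) Y = col_mx 0 G /\ \det G = 1.
Proof.
move=> e [shapeX shapeY trigG diagG].
pose p := fun i : 'I_m.+2 => l i.+1.
have XE (i j : 'I_m.+2) a c : (i < m.+1)%N ->
    X (tagnat.Rank (p_ := p) i a) (tagnat.Rank (p_ := p) j c) =
    (if j == i.+1 :> nat then pad_id F (l i.+1) (l j.+1) else 0) a c.
  by move=> /shapeX-/(_ j) /matrixP /(_ a c); rewrite mxE.
have YE (i : 'I_m.+2) a c : (i < m.+1)%N -> Y (tagnat.Rank (p_ := p) i a) c = 0.
  by move=> /shapeY /matrixP /(_ a c); rewrite !mxE.
set X' := castmx _ X; set Y' := castmx _ Y.
have lt_fst (i : 'I_m) : (i < m.+1)%N by rewrite ltnS ltnW.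
have castE := (cast_ord_first, cast_ord_penult, cast_ord_last).
exists (dlsubmx X'), (drsubmx X'), (dsubmx Y').
  rewrite -[X' in LHS]submxK; congr block_mx.
    rewrite -[ulsubmx X']submxK; congr block_mx; apply/matrixP => i j;
      rewrite !mxE castmxE !castE XE //=.
    - by rewrite eq_sym.
    - by rewrite (ltn_eqF (lt_fst _)) mxE.
    - by rewrite (ltn_eqF (ltnSn m)) mxE.
  rewrite -[ursubmx X']vsubmxK; congr col_mx; apply/matrixP => i j;
    rewrite !mxE castmxE !castE XE //= ?eqxx ?mxE //.
  by rewrite eqSS (gtn_eqF (ltn_ord _)) mxE.
have <- : castmx (erefl, erefl) (submxcol (p_ := p) Y ord_max) = dsubmx Y'.
  by apply/matrixP => i j; rewrite castmx_id !mxE castmxE !castE cast_ord_id.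
split; last by rewrite det_trig // big1.
rewrite castmx_id -[LHS]vsubmxK; congr col_mx.
  rewrite -[LHS]vsubmxK -[RHS]vsubmxK; congr col_mx; apply/matrixP => i j;
    by rewrite !mxE castmxE !castE cast_ord_id YE //=.
by apply/matrixP => i j; rewrite !mxE castmxE !castE cast_ord_id.
Qed.

Lemma row_blocks (F : fieldType) m (l : nat -> nat) r
    (X : 'M[F]_(r, \sum_(i < m.+2) l i.+1)) :
  castmx (erefl r, sum_split_last2 m l) X =
  row_mx (row_mx (\mxrow_(i < m) col_block X (first_block i))
                 (col_block X (penult_block m)))
         (col_block X ord_max).
Proof.
have castE := (cast_ord_first, cast_ord_penult, cast_ord_last).
rewrite -[LHS]hsubmxK; congr row_mx.
  rewrite -[LHS]hsubmxK; congr row_mx; apply/matrixP => i j;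
    by rewrite !mxE castmxE cast_ord_id !castE.
by apply/matrixP => i j; rewrite !mxE castmxE cast_ord_id !castE.
Qed.

(** Only the last block can be nonzero, and there [O, I_p] [O, I_q] = [O, I_p] with p = l_m <= q =
    l_(m+1). *)
Lemma chain_link_pad (F : fieldType) m (l : nat -> nat) q :
  (l m <= l m.+1)%N ->
  chain_link F m l (l m.+1) *m pad_id F (l m.+1) q = chain_link F m l q.
Proof.
move=> le_l; rewrite /chain_link mxcol_mul; apply: eq_mxcol => i.
case: eqP => [e|_]; last exact: mul0mx.
by rewrite pad_id_mul // e.
Qed.

(** * The pencil and the system determinant *)

(** This brings Z(s) to the left-hand matrix of [det_chain_elim], whose [V] is minus the chain
    link. *)
Lemma pencil_Z (F : fieldType) m (l : nat -> nat) (CN : 'M[F]_(_, _)) :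
  (l m <= l m.+1)%N ->
  pencil (Zlead (erefl (l m.+2)) CN) (Zconst CN) =
  block_mx ('X%:M - map_mx polyC (chain_mx F m l))
    (- map_mx polyC (chain_link F m l (l m.+1)) *m
       map_mx polyC (pad_id F (l m.+1) (l m.+2)))
    (map_mx polyC (\mxrow_(i < m) col_block CN (first_block i)))
    (map_mx polyC (col_block CN (penult_block m)) *m
       map_mx polyC (pad_id F (l m.+1) (l m.+2)) +
     'X *: map_mx polyC (col_block CN ord_max)).
Proof.
move=> le_l; rewrite mulNmx -!map_mxM chain_link_pad // /pencil /Zlead /Zconst castmx_id.
rewrite /Ebar -/(chain_mx F m l) -/(chain_link F m l (l m.+2)) opp_row_mx.
rewrite -/(block_mx _ _ _ _) !map_block_mx !map_mxN map_mx1 !map_mx0 scale_block_mx.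
by rewrite add_block_mx !scaler0 !add0r scalemx1 [X in block_mx _ _ _ X]addrC.
Qed.

Lemma det_pencil_Z (F : fieldType) m r (l : nat -> nat) (lr : l m.+2 = r)
    (X : 'M[F]_(\sum_(i < m.+2) l i.+1)) (Y : 'M[F]_(_, r)) (CN : 'M[F]_(r, _)) :
  (l m <= l m.+1)%N -> yokoyama_shape lr X Y ->
  exists2 c : {poly F}, c \is a GRing.unit &
    'X^(l m.+1) * \det (pencil (Zlead lr CN) (Zconst CN)) =
    c * ('X^r * \det (system_mx X Y CN)).
Proof.
case: _ / lr Y CN => Y CN le_l /yokoyama_blocks [XL [XR [G XE [YE detG]]]].
rewrite pencil_Z // det_chain_elim -(system_mx_cast (sum_split_last2 m l)).
rewrite XE YE row_blocks.
set Q := block_mx _ _ _ _.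
pose S := swap_mx {poly F} (\sum_(i < m) l i.+1 + l m.+1) (l m.+2) (l m.+2).
pose g := \det (map_mx polyC (- G)).
(* The swap is an involution, so its determinant is its own inverse. *)
have uS : \det S \is a GRing.unit.
  by apply/unitrP; exists (\det S); rewrite -det_mulmx swap_mxK det1.
have ug : g \is a GRing.unit.
  rewrite /g det_map_mx -scaleN1r detZ detG mulr1 rmorphXn rmorphN1.
  by rewrite unitrX // unitrN1.
(* By [det_bordered], det S det P = g det Q. *)
exists (g^-1 * \det S); first by rewrite unitrM unitrV ug.
rewrite mulrCA; congr (_ * _).
set P := system_mx _ _ _.
(* P(s) is Q(s) bordered by the last block row of the state equation and by the input columns. *)
have -> : P =
    block_mx (col_mx (usubmx Q) (row_mx (- map_mx polyC XL) ('X%:M - map_mx polyC XR)))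
      (col_mx 0 (map_mx polyC (- G))) (dsubmx Q) 0.
  rewrite [usubmx Q]col_mxKu [dsubmx Q]col_mxKd /P /system_mx; congr block_mx.
  - rewrite map_block_mx map_block_mx map_col_mx !map_mx0 2!scalar_mx_block.
    rewrite !opp_block_mx opp_col_mx !add_block_mx.
    by rewrite !oppr0 !(addr0, add0r).
  - by rewrite map_col_mx map_mx0 opp_col_mx oppr0 map_mxN.
  - by rewrite !map_row_mx.
by rewrite -mulrA det_bordered vsubmxK -/g [\det Q * g]mulrC mulKr.
Qed.

(** * Multiplicities of the zeros *)

Lemma normal_rank_full (F : fieldType) n (P : 'M[{poly F}]_n) :
  normal_rank P = n -> \det P != 0.
Proof.
move=> rP; rewrite -tofrac_eq0 -det_map_mx -unitfE -unitmxE -row_free_unit.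
exact/eqP.
Qed.

(** Multiplicities add over a nonzero product, and X^k vanishes only at the origin. *)
Lemma zero_multZX (R : rcfType) (u : R) k (q : {poly R}) (z : R[i]) :
  u != 0 -> q != 0 ->
  zero_mult (u%:P * ('X^k * q)) z = ((if z == 0%R then k else 0) + zero_mult q z)%N.
Proof.
move=> u0 q0; rewrite /zero_mult !rmorphM /= map_polyC map_polyXn.
rewrite mupMr ?rootC ?fmorph_eq0 // mupM ?map_poly_eq0 ?expf_neq0 ?polyX_eq0 //.
by rewrite -['X]subr0 -[0](polyC0) mup_XsubCX eq_sym.
Qed.

Theorem theorem7p7 (R : realType) (n r m : nat)
    (A : 'M[R]_n) (B : 'M[R]_(n, r)) (C : 'M[R]_(r, n))
    (rB : \rank B = r)
    (cAB : controllable A B)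
    (nuE : ctrb_index A B = m.+2)
    (rP : normal_rank (system_mx A B C) = (n + r)%N)
    (N : 'M[R]_n) (M : 'M[R]_r)
    (NM : yokoyama_form rB cAB nuE N M) :
  let l := ctrb_size A B in
  let CN := castmx (erefl r, esym (ctrb_size_sum cAB nuE)) (C *m invmx N) in
  let Z1 := Zlead (ctrb_size_last rB nuE) CN in
  let Z0 := Zconst CN in
  [/\ (\sum_(i < m) l i.+1 + r = n - l m.+1)%N,
      regular_pencil Z1 Z0,
      (r - l m.+1 <= zero_mult (\det (pencil Z1 Z0)) 0%R)%N
    & forall z : R[i],
        zero_mult (\det (system_mx A B C)) z =
        (zero_mult (\det (pencil Z1 Z0)) z - (if z == 0%R then r - l m.+1 else 0))%N].
Proof.
move=> l CN Z1 Z0; have [uN pM shapeNM] := NM.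
(* Concavity at k = 0, where l_nu = r. *)
have le_pr : (l m.+1 <= r)%N.
  rewrite -[leqRHS](ctrb_size_last rB nuE) /l /ctrb_size nuE subSnn subnn.
  exact: ctrb_rank_concave.
(* Concavity at k = 1. For m = 0, [l 0] is no block size, but it is still a difference of ranks. *)
have le_l : (l m <= l m.+1)%N.
  rewrite /l /ctrb_size nuE subSnn -addn2 addKn.
  exact: ctrb_rank_concave.
have [c uc] := det_pencil_Z CN le_l shapeNM.
rewrite system_mx_cast det_system_mx_equiv // -/Z1 -/Z0 -/l.
(* The units of R[X] are the nonzero constants, and the determinant of a permutation matrix is a
   unit. *)
have [u u0 uE] : exists2 u : R, u != 0 & c * (\det M)%:P = u%:P.
  have uM : \det M \is a GRing.unit.
    by have /is_perm_mxP [s ->] := pM; rewrite -unitmxE unitmx_perm.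
  have : c * (\det M)%:P \is a GRing.unit by rewrite unitrM uc rmorph_unit.
  rewrite poly_unitE unitfE => /andP [/eqP szu u0].
  by exists (c * (\det M)%:P)`_0 => //; apply: size1_polyC; rewrite szu.
have P0 := normal_rank_full rP.
(* As l_(nu-1) <= r, the factor X^(l_(nu-1)) cancels, leaving det Z = u X^(r - l_(nu-1)) det P. *)
have -> : 'X^r = 'X^(l m.+1) * 'X^(r - l m.+1) :> {poly R}.
  by rewrite -exprD subnKC.
rewrite -!mulrA mulrCA => /(mulfI (monic_neq0 (monicXn _ _))).
rewrite [X in c * X]mulrA [X in c * X]mulrC mulrA uE => detZ.
have Zmult z := zero_multZX (r - l m.+1) z u0 P0.
rewrite -detZ in Zmult.
split=> [||| z].
- have := ctrb_size_sum cAB nuE.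
  by rewrite !big_ord_recr /= (ctrb_size_last rB nuE) -/l addnAC => /(canRL (addnK _)).
- by rewrite /regular_pencil detZ !mulf_neq0 ?polyC_eq0 ?(monic_neq0 (monicXn _ _)).
- by rewrite Zmult eqxx leq_addr.
- by rewrite Zmult addKn.
Qed.
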